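(* Let $A\in\mathbb{R}^{n\times n}$, $B\in\mathbb{R}^{n\times p}$, $C\in\mathbb{R}^{m\times n}$, let $P_0\in\mathbb{R}^{n\times n}$ be symmetric and nonnegative, and let $T>0$. Given $\xi\in\mathbb{R}^n$, let $\tilde u\in L^2((0,T);\mathbb{R}^p)$ be the optimal control for the problem $$\inf_{u\in L^2((0,T);\mathbb{R}^p)}\ \int_0^T\big(\|Cx(s)\|^2+\|u(s)\|^2\big)\,ds+\langle P_0x(T),x(T)\rangle,\qquad x'=Ax+Bu\ \text{ in }(0,T),\ x(0)=\xi,$$ and let $\tilde x$ be the corresponding solution. Then $$\tilde x'=A\tilde x+B\tilde u\ \text{ in }(0,T),\qquad \tilde x(0)=\xi,$$ and $$\tilde u=-B^\top\tilde y\ \text{ in }(0,T),\quad\text{where}\quad \tilde y'=-A^\top\tilde y-C^\top C\tilde x\ \text{ in }(0,T),\qquad \tilde y(T)=P_0\tilde x(T).$$ Moreover, $$\tilde y(t)=P_T(t)\tilde x(t)\ \text{ in }[0,T].$$ Consequently, $\tilde u(t)=-B^\top P_T(t)\tilde x(t)$ in $[0,T]$.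
   Context: $\|\cdot\|$ and $\langle\cdot,\cdot\rangle$ are the Euclidean norm and scalar product. The optimal control exists and is unique. For $\tau\in[0,T)$, $P_T(\tau)$ is the $n\times n$ symmetric matrix defined by $$\langle P_T(\tau)\eta,\eta\rangle=\inf_{u\in L^2((\tau,T);\mathbb{R}^p)}\ \int_\tau^T\big(\|Cx(s)\|^2+\|u(s)\|^2\big)\,ds+\langle P_0x(T),x(T)\rangle\quad\text{for }\eta\in\mathbb{R}^n,$$ where $x'=Ax+Bu$ in $(\tau,T)$ and $x(\tau)=\eta$ (the infimum is a quadratic function of $\eta$), and $P_T(T)=P_0$. Identities involving the $L^2$ function $\tilde u$ are understood almost everywhere. *)

(* Defs.v *)
From HB Require Import structures.
From mathcomp Require Import all_boot all_order all_algebra.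
From mathcomp Require Import all_classical all_reals all_analysis.

Set Implicit Arguments.
Unset Strict Implicit.
Unset Printing Implicit Defensive.

Import Order.TTheory GRing.Theory Num.Theory.
Import numFieldNormedType.Exports.

Local Open Scope classical_set_scope.
Local Open Scope ring_scope.

Definition dot (R : realType) (k : nat) (v w : 'cV[R]_k) : R :=
  \sum_(i < k) v i ord0 * w i ord0.

(* The library's norm on matrices is the sup norm. *)
Definition enorm (R : realType) (k : nat) (v : 'cV[R]_k) : R :=
  Num.sqrt (dot v v).

Definition L2 (R : realType) (k : nat) (a b : R) (u : R -> 'cV[R]_k) : Prop :=
  (forall i : 'I_k, measurable_fun `]a, b[ (fun s => u s i ord0)) /\
  (\int[lebesgue_measure]_(s in `]a, b[) ((enorm (u s)) ^+ 2)%:E < +oo)%E.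

(* Absolute continuity on [a, b], as being the primitive of an integrable
   function. *)
Definition abs_continuous (R : realType) (k : nat) (a b : R)
    (z : R -> 'cV[R]_k) : Prop :=
  exists g : R -> 'cV[R]_k, forall i : 'I_k,
    (@lebesgue_measure R).-integrable `]a, b[ (fun s => (g s i ord0)%:E) /\
    forall t : R, a <= t <= b ->
      z t i ord0 =
      z a i ord0 + \int[lebesgue_measure]_(s in `]a, t[) g s i ord0.

(* z' = f in (a, b), in the sense of Caratheodory: a control in L^2 is only
   defined almost everywhere, so the equation cannot be asked at every point. *)
Definition ode (R : realType) (k : nat) (a b : R)
    (z f : R -> 'cV[R]_k) : Prop :=
  abs_continuous a b z /\
  {ae (@lebesgue_measure R), forall t : R, t \in `]a, b[ ->
     forall i : 'I_k,
       is_derive t (1 : R) (fun s : R => z s i ord0) (f t i ord0)}.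

Definition state_eq (R : realType) (n p : nat)
    (A : 'M[R]_n) (B : 'M[R]_(n, p)) (tau T : R) (eta : 'cV[R]_n)
    (u : R -> 'cV[R]_p) (x : R -> 'cV[R]_n) : Prop :=
  ode tau T x (fun t => A *m x t + B *m u t) /\ x tau = eta.

Definition adjoint_eq (R : realType) (n m : nat)
    (A : 'M[R]_n) (C : 'M[R]_(m, n)) (P0 : 'M[R]_n) (T : R)
    (x y : R -> 'cV[R]_n) : Prop :=
  ode 0 T y (fun t => - (A^T *m y t) - C^T *m C *m x t) /\
  y T = P0 *m x T.

Definition cost (R : realType) (n m p : nat)
    (C : 'M[R]_(m, n)) (P0 : 'M[R]_n) (tau T : R)
    (u : R -> 'cV[R]_p) (x : R -> 'cV[R]_n) : \bar R :=
  (\int[lebesgue_measure]_(s in `]tau, T[)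
      ((enorm (C *m x s)) ^+ 2 + (enorm (u s)) ^+ 2)%:E
   + (dot (P0 *m x T) (x T))%:E)%E.

Definition optimal_value (R : realType) (n m p : nat)
    (A : 'M[R]_n) (B : 'M[R]_(n, p)) (C : 'M[R]_(m, n)) (P0 : 'M[R]_n)
    (tau T : R) (eta : 'cV[R]_n) : \bar R :=
  ereal_inf [set c | exists (u : R -> 'cV[R]_p) (x : R -> 'cV[R]_n),
    [/\ L2 tau T u, state_eq A B tau T eta u x & c = cost C P0 tau T u x]].

Definition optimal_control (R : realType) (n m p : nat)
    (A : 'M[R]_n) (B : 'M[R]_(n, p)) (C : 'M[R]_(m, n)) (P0 : 'M[R]_n)
    (T : R) (xi : 'cV[R]_n) (u : R -> 'cV[R]_p) : Prop :=
  L2 0 T u /\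
  exists x : R -> 'cV[R]_n,
    state_eq A B 0 T xi u x /\
    cost C P0 0 T u x = optimal_value A B C P0 0 T xi.

Definition value_matrix (R : realType) (n m p : nat)
    (A : 'M[R]_n) (B : 'M[R]_(n, p)) (C : 'M[R]_(m, n)) (P0 : 'M[R]_n)
    (T : R) (P : R -> 'M[R]_n) : Prop :=
  (forall tau : R, 0 <= tau < T ->
     (P tau)^T = P tau /\
     forall eta : 'cV[R]_n,
       (dot (P tau *m eta) eta)%:E = optimal_value A B C P0 tau T eta) /\
  P T = P0.

(* Main.v *)
(* Perturb (u, x) on (t, T) by e (v, z), where z' = A z + B v, z(t) = zeta and
   v is constant.  By dynamic programming the tail of (u, x) is optimal, so
   <P(t) eta, eta> <= cost, with eta = x(t) + e zeta, is an inequality between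
   two quadratic polynomials in e which are equal at e = 0; hence their linear
   terms agree.  Integrating <y, z>' turns this into
     <P(t) x(t), zeta> = <y(t), zeta> + int_t^T <u + B^T y, v>
   for all zeta and v.  Taking v = 0 gives y = P x; taking zeta = 0 shows that
   the primitive of u + B^T y vanishes, hence u = - B^T y almost everywhere by
   Lebesgue differentiation.  Since v is constant, the auxiliary equations have
   continuous coefficients and are solved with the matrix exponential. *)
Require Import Defs.
From HB Require Import structures.
From mathcomp Require Import all_boot all_order all_algebra.
From mathcomp Require Import all_classical all_reals all_analysis.
From mathcomp Require Import measurable_realfun ring lra.

Import Order.TTheory GRing.Theory Num.Theory.
Import numFieldNormedType.Exports.

Local Open Scope classical_set_scope.
Local Open Scope ring_scope.

(** * Entrywise calculus of matrix-valued functions *)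

Section MatrixCalculus.
Set Implicit Arguments.
Unset Strict Implicit.
Context {R : realType}.

(** Derivatives are taken entry by entry, as in [ode], so that no norm on matrices intervenes. *)
Definition mxderiv m n (t : R) (G : R -> 'M[R]_(m, n)) (G' : 'M[R]_(m, n)) :=
  forall i j, is_derive t (1 : R) (fun s : R => G s i j) (G' i j).

Definition mxcont m n (D : set R) (G : R -> 'M[R]_(m, n)) :=
  forall i j, {within D, continuous (fun s : R => G s i j)}.

Lemma mxderivD m n t (G H : R -> 'M[R]_(m, n)) G' H' :
  mxderiv t G G' -> mxderiv t H H' ->
  mxderiv t (fun s => G s + H s) (G' + H').
Proof.
move=> dG dH i j.
rewrite (_ : (fun s : R => _) = (fun s => G s i j) \+ (fun s => H s i j)).
  by rewrite mxE; exact: is_deriveD.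
by apply/funext => s /=; rewrite mxE.
Qed.

Lemma mxderiv_cst m n t (G : 'M[R]_(m, n)) : mxderiv t (fun=> G) 0.
Proof. by move=> i j; rewrite mxE; exact: is_derive_cst. Qed.

Lemma mxderivM m n p t (G : R -> 'M[R]_(m, n)) (H : R -> 'M[R]_(n, p)) G' H' :
  mxderiv t G G' -> mxderiv t H H' ->
  mxderiv t (fun s => G s *m H s) (G' *m H t + G t *m H').
Proof.
move=> dG dH i j.
rewrite (_ : (fun s : R => _) =
    \sum_(k < n) ((fun s => G s i k) * (fun s => H s k j))).
  have -> : (G' *m H t + G t *m H') i j =
    \sum_(k < n) (G t i k *: H' k j + H t k j *: G' i k).
    rewrite !mxE -big_split; apply: eq_bigr => k _ /=.
    by rewrite addrC [X in _ + X]mulrC.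
  by apply: is_derive_sum => k; exact: is_deriveM.
by apply/funext => s /=; rewrite mxE fct_sumE.
Qed.

Lemma mxcontD m n D (G H : R -> 'M[R]_(m, n)) :
  mxcont D G -> mxcont D H -> mxcont D (fun s => G s + H s).
Proof.
move=> cG cH i j.
rewrite (_ : (fun s : R => _) = (fun s => G s i j) \+ (fun s => H s i j)).
  by move=> s; apply: cvgD; [exact: cG|exact: cH].
by apply/funext => s /=; rewrite mxE.
Qed.

Lemma mxcontM m n p D (G : R -> 'M[R]_(m, n)) (H : R -> 'M[R]_(n, p)) :
  mxcont D G -> mxcont D H -> mxcont D (fun s => G s *m H s).
Proof.
move=> cG cH i j.
rewrite (_ : (fun s : R => _) = fun s => \sum_(k < n) (G s i k * H s k j)).
  move=> s; apply: cvg_big => [|k _]; first exact: add_continuous.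
  by apply: cvgM; [exact: cG|exact: cH].
by apply/funext => s /=; rewrite mxE.
Qed.

Lemma mxcont_cst m n D (G : 'M[R]_(m, n)) : mxcont D (fun=> G).
Proof. by move=> i j s; exact: cvg_cst. Qed.

Lemma mxcont_mulcl m n p D (M : 'M[R]_(m, n)) (G : R -> 'M[R]_(n, p)) :
  mxcont D G -> mxcont D (fun s => M *m G s).
Proof. by move=> cG; apply: mxcontM => //; exact: mxcont_cst. Qed.

Lemma mxcont_tr m n D (G : R -> 'M[R]_(m, n)) :
  mxcont D G -> mxcont D (fun s => (G s)^T).
Proof.
move=> cG i j; rewrite (_ : (fun s : R => _) = fun s => G s j i) //.
by apply/funext => s; rewrite mxE.
Qed.

Lemma mxderiv_tr m n t (G : R -> 'M[R]_(m, n)) G' :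
  mxderiv t G G' -> mxderiv t (fun s => (G s)^T) G'^T.
Proof.
move=> dG i j; rewrite mxE (_ : (fun s : R => _) = fun s => G s j i) //.
by apply/funext => s; rewrite mxE.
Qed.

Lemma mxderiv_mxcont m n (D : set R) (G G' : R -> 'M[R]_(m, n)) :
  (forall t, mxderiv t G (G' t)) -> mxcont D G.
Proof.
move=> dG i j; apply: continuous_subspaceT => t.
by apply/differentiable_continuous/derivable1_diffP; case: (dG t i j).
Qed.

End MatrixCalculus.

(** * The matrix exponential as a matrix of scalar power series *)

Section MatrixExponential.
Set Implicit Arguments.
Unset Strict Implicit.
Context {R : realType} {n : nat}.
Implicit Type M : 'M[R]_n.

(** Each entry of exp(tM) is a real power series in t, so convergence and termwise differentiation
    come from the scalar theory of [pseries]. *)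
Definition expmx_coef M i j (k : nat) : R := (M ^+ k) i j / k`!%:R.

Definition expmx M (t : R) : 'M[R]_n :=
  \matrix_(i, j) limn (pseries (expmx_coef M i j) t).

Lemma expmx_coef_bound M : exists2 c : R, 0 <= c &
  forall k i j, `|expmx_coef M i j k| <= c ^+ k / k`!%:R.
Proof.
(* A product by [M] sums [n] terms, each at most [b] times the bound for the previous power; hence
   entries of the k-th power are at most the k-th power of [b * n + 1]. *)
pose b := \sum_i \sum_j `|M i j|; exists (b * n%:R + 1).
  by rewrite addr_ge0// mulr_ge0// sumr_ge0// => i _; rewrite sumr_ge0.
have b0 : 0 <= b by rewrite sumr_ge0// => i _; rewrite sumr_ge0.
have Mb i j : `|M i j| <= b.
  rewrite /b (bigD1 i)//= (bigD1 j)//= -addrA lerDl addr_ge0//.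
    by rewrite sumr_ge0.
  by rewrite sumr_ge0// => ? _; rewrite sumr_ge0.
move=> k i j; rewrite /expmx_coef normrM [X in _ * X]ger0_norm//.
rewrite ler_pM2r ?invr_gt0 ?ltr0n ?fact_gt0//.
elim: k i j => [|k IH] i j.
  by rewrite !expr0 mxE; case: (i == j); rewrite ?normr1 ?normr0.
rewrite exprS mxE (le_trans (ler_norm_sum _ _ _))//.
apply: (@le_trans _ _ (\sum_(l < n) b * (b * n%:R + 1) ^+ k)).
  by apply: ler_sum => l _; rewrite normrM ler_pM.
rewrite sumr_const card_ord -[leLHS]mulr_natl mulrA [n%:R * b]mulrC exprS.
by rewrite ler_wpM2r ?exprn_ge0 ?lerDl// addr_ge0// mulr_ge0.
Qed.

(** The series is dominated by the scalar exponential series at c|t|, with c the growth rate from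
    [expmx_coef_bound]. *)
Lemma is_cvg_expmx_coef M i j t : cvgn (pseries (expmx_coef M i j) t).
Proof.
have [c c0 cM] := expmx_coef_bound M.
apply: normed_cvg; apply: (@series_le_cvg _ _ (exp_coeff (c * `|t|))).
- by move=> k /=.
- by move=> k; rewrite /exp_coeff /= divr_ge0// exprn_ge0// mulr_ge0.
- move=> k; rewrite /exp_coeff /= normrM normrX exprMn.
  by rewrite [leRHS]mulrAC ler_wpM2r// exprn_ge0.
- exact: is_cvg_series_exp_coeff.
Qed.

(** This is exp(tM)' = M exp(tM) at the level of coefficients: the factor k + 1 produced by
    differentiation cancels against the factorial. *)
Lemma pseries_diffs_expmx_coef M i j :
  pseries_diffs (expmx_coef M i j) =
  fun k => \sum_(l < n) M i l * expmx_coef M l j k.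
Proof.
apply/funext => k; rewrite /pseries_diffs /expmx_coef exprS mxE factS natrM.
rewrite invfM mulrCA mulVKf ?pnatr_eq0// mulr_suml.
by apply: eq_bigr => l _; rewrite mulrA.
Qed.

Lemma pseries_sum (c : 'I_n -> R) (f : 'I_n -> nat -> R) (t : R) :
  (forall l, cvgn (pseries (f l) t)) ->
  pseries (fun k => \sum_(l < n) c l * f l k) t @ \oo -->
  \sum_(l < n) c l * limn (pseries (f l) t).
Proof.
move=> cf.
rewrite (_ : pseries _ _ = fun N => \sum_(l < n) c l * pseries (f l) t N).
  apply: cvg_big => [|l _]; first exact: add_continuous.
  by apply: cvgM; [exact: cvg_cst|exact: cf].
apply/funext => N; rewrite /pseries /series /=.
under eq_bigr do rewrite mulr_suml.
rewrite exchange_big; apply: eq_bigr => l _.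
by rewrite mulr_sumr; apply: eq_bigr => k _; rewrite mulrA.
Qed.

Lemma mxderiv_expmx M t : mxderiv t (expmx M) (M *m expmx M t).
Proof.
move=> i j; pose c := expmx_coef M i j.
have cvS (f : 'I_n -> nat -> R) i' s : (forall l, cvgn (pseries (f l) s)) ->
    cvgn (pseries (fun k => \sum_(l < n) M i' l * f l k) s).
  by move=> cf; apply/cvg_ex; eexists; exact: pseries_sum.
have -> : (fun s => expmx M s i j) = fun s => limn (pseries c s).
  by apply/funext => s; rewrite mxE.
have -> : (M *m expmx M t) i j = limn (pseries (pseries_diffs c) t).
  rewrite pseries_diffs_expmx_coef mxE; apply/esym/cvg_lim => //.
  under [X in _ --> X]eq_bigr do rewrite mxE.
  by apply: pseries_sum => l; exact: is_cvg_expmx_coef.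
(* Termwise differentiation at t asks that the series and its first two derived series converge at
   some point of modulus larger than |t|. The derived series are linear combinations of the original
   ones, which converge everywhere. *)
apply: (@pseries_snd_diffs _ _ (`|t| + 1)).
- exact: is_cvg_expmx_coef.
- rewrite pseries_diffs_expmx_coef; apply: cvS => l; exact: is_cvg_expmx_coef.
- rewrite pseries_diffs_expmx_coef.
  have -> : pseries_diffs (fun k => \sum_(l < n) M i l * expmx_coef M l j k) =
     fun k => \sum_(l < n) M i l * pseries_diffs (expmx_coef M l j) k.
    apply/funext => k; rewrite /pseries_diffs mulr_sumr; apply: eq_bigr => l _.
    by rewrite mulrCA.
  apply: (cvS (fun l => pseries_diffs (expmx_coef M l j))) => l.
  rewrite pseries_diffs_expmx_coef; apply: cvS => l'.
  exact: is_cvg_expmx_coef.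
- by rewrite [ltRHS]ger0_norm// ?addr_ge0// ltrDl.
Qed.

Lemma expmx0 M : expmx M 0 = 1%:M.
Proof.
apply/matrixP => i j; rewrite mxE; apply/cvg_lim => //.
apply: cvg_near_cst; near=> N.
have N0 : (0 < N)%N by near: N; exact: nbhs_infty_gt.
rewrite /pseries /series /=.
rewrite big_ltn// expr0 mulr1 /expmx_coef expr0 fact0 divr1.
rewrite big_nat big1 ?addr0//.
by move=> [|k]// _; rewrite expr0n mulr0.
Unshelve. all: by end_near. Qed.

Lemma comm_expmx M t : M *m expmx M t = expmx M t *m M.
Proof.
apply/matrixP => i j; rewrite !mxE.
under eq_bigr do rewrite mxE.
under [RHS]eq_bigr do rewrite mxE mulrC.
have cvE i' j' : cvgn (pseries (expmx_coef M i' j') t).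
  exact: is_cvg_expmx_coef.
have h1 := @pseries_sum (fun l => M i l) _ t (cvE^~ j).
have h2 := @pseries_sum (fun l => M l j) _ t (cvE i).
rewrite -(cvg_lim _ h1)// -(cvg_lim _ h2)//; congr (limn (pseries _ _)).
apply/funext => k.
have /matrixP/(_ i j) : M *m M ^+ k = M ^+ k *m M := commrX k (commr_refl M).
rewrite !mxE => /(congr1 ( *%R^~ (k`!%:R^-1))); rewrite /= !mulr_suml => h.
under eq_bigr do rewrite mulrA.
by rewrite h; apply: eq_bigr => l _; rewrite mulrAC mulrC.
Qed.

Lemma mxderiv_expmxN M t :
  mxderiv t (fun s => expmx M (- s)) (- (M *m expmx M (- t))).
Proof.
move=> i j; rewrite mxE -mulrN1.
exact: (@is_derive1_comp _ (fun s => expmx M s i j) -%R t _ _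
  (mxderiv_expmx M (- t) i j)).
Qed.

(** The product has zero derivative, because [M] commutes with its exponential, so it keeps the
    value it has at 0. *)
Lemma expmx_cancel M t : expmx M t *m expmx M (- t) = 1%:M.
Proof.
apply/matrixP => i j.
rewrite -[RHS](_ : (expmx M 0 *m expmx M (- 0)) i j = _); last first.
  by rewrite oppr0 expmx0 mul1mx.
apply: (@is_derive_0_is_cst _ (fun s => (expmx M s *m expmx M (- s)) i j)) => s.
have := mxderivM (mxderiv_expmx M s) (mxderiv_expmxN M s).
move=> /(_ i j); rewrite mulmxN mulmxA comm_expmx subrr mxE; exact.
Qed.

End MatrixExponential.

(** * Integration on intervals *)

Section RealIntegrable.
Set Implicit Arguments.
Unset Strict Implicit.
Context {R : realType}.
Notation mu := (@lebesgue_measure R).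
Implicit Types (a b : R).

Lemma integrable_addr a b (f g : R -> R) :
  mu.-integrable `]a, b[ (EFin \o f) -> mu.-integrable `]a, b[ (EFin \o g) ->
  mu.-integrable `]a, b[ (EFin \o (fun s => f s + g s)).
Proof.
move=> if_ ig.
have -> : EFin \o (fun s => f s + g s) = ((EFin \o f) \+ (EFin \o g))%E.
  by apply/funext => s; rewrite /= EFinD.
by apply: integrableD.
Qed.

Lemma integrable_scaler a b (k : R) (f : R -> R) :
  mu.-integrable `]a, b[ (EFin \o f) ->
  mu.-integrable `]a, b[ (EFin \o (fun s => k * f s)).
Proof.
move=> if_.
have -> : EFin \o (fun s => k * f s) = (fun s => k%:E * (EFin \o f) s)%E.
  by apply/funext => s; rewrite /= EFinM.
by apply: integrableZl.
Qed.

Lemma integrable_sumr a b I (r : seq I) (f : I -> R -> R) :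
  (forall i, mu.-integrable `]a, b[ (EFin \o f i)) ->
  mu.-integrable `]a, b[ (EFin \o (fun s => \sum_(i <- r) f i s)).
Proof.
move=> if_.
have -> : EFin \o (fun s => \sum_(i <- r) f i s) =
    (fun s => \sum_(i <- r) (EFin \o f i) s)%E.
  by apply/funext => s; rewrite /= sumEFin.
by apply: integrable_sum.
Qed.

Lemma Rintegral_linear a b (k l : R) (f g h : R -> R) :
  mu.-integrable `]a, b[ (EFin \o f) -> mu.-integrable `]a, b[ (EFin \o g) ->
  mu.-integrable `]a, b[ (EFin \o h) ->
  \int[mu]_(s in `]a, b[) (f s + (k * g s + l * h s)) =
  \int[mu]_(s in `]a, b[) f s +
    (k * \int[mu]_(s in `]a, b[) g s + l * \int[mu]_(s in `]a, b[) h s).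
Proof.
move=> if_ ig ih; rewrite RintegralD//.
  by rewrite RintegralD ?RintegralZl//; exact: integrable_scaler.
by apply: integrable_addr; exact: integrable_scaler.
Qed.

(** Endpoints are null. This links the open intervals of the problem to the closed ones of the
    fundamental theorem of calculus. *)
Lemma integrable_itv_cc a b g :
  mu.-integrable `]a, b[ (EFin \o g) -> mu.-integrable `[a, b] (EFin \o g).
Proof.
move=> ig; have /measurable_EFinP mg := measurable_int mu ig.
have mg' : measurable_fun `[a, b] g by exact: measurable_fun_itv_cc mg.
have mgo : measurable_fun `]a, b] g by exact: measurable_fun_itv_oc mg.
apply/integrableP; split; first exact/measurable_EFinP.
move/integrableP : ig => [_].
rewrite integral_itv_bndo_bndc; last first.
  by do 2 apply: measurableT_comp => //.
by rewrite integral_itv_obnd_cbnd//; do 2 apply: measurableT_comp => //.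
Qed.

Lemma Rintegral_itv_cc a b g : mu.-integrable `]a, b[ (EFin \o g) ->
  \int[mu]_(s in `]a, b[) g s = \int[mu]_(s in `[a, b]) g s.
Proof.
move=> /integrable_itv_cc ig; rewrite Rintegral_itv_bndo_bndc.
  rewrite Rintegral_itv_obnd_cbnd//.
  by apply: integrableS ig => //; exact: subset_itv_oc_cc.
by apply: integrableS ig => //; exact: subset_itv_oo_cc.
Qed.

Lemma integrable_within_continuous a b f :
  {within `[a, b], continuous f} -> mu.-integrable `]a, b[ (EFin \o f).
Proof.
move=> cf; apply: (@integrableS _ _ _ mu `[a, b]) => //.
  exact: subset_itv_oo_cc.
by apply: continuous_compact_integrable => //; exact: segment_compact.
Qed.

Lemma Rintegral_itv_split a b c g : a <= b -> b <= c ->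
  mu.-integrable `]a, c[ (EFin \o g) ->
  \int[mu]_(s in `]a, c[) g s =
  \int[mu]_(s in `]a, b[) g s + \int[mu]_(s in `]b, c[) g s.
Proof.
move=> ab bc ig; have ig' := integrable_itv_cc ig.
have sub x y : a <= x -> y <= c -> mu.-integrable `]x, y[ (EFin \o g).
  move=> ax yc; apply: integrableS ig => //.
  by apply: subset_itv; rewrite bnd_simp.
rewrite !Rintegral_itv_cc ?sub//.
have ab' : (BLeft a <= BRight b)%O by rewrite bnd_simp.
have bc' : (BRight b <= BRight c)%O by rewrite bnd_simp.
have := Rintegral_itvB ig' ab' bc'; rewrite Rintegral_itv_obnd_cbnd.
  by move/eqP; rewrite subr_eq addrC => /eqP.
apply: integrableS ig' => //.
by apply: subset_itv; rewrite bnd_simp.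
Qed.

Lemma integrable_if a b c (f g : R -> R) : a <= c -> c <= b ->
  mu.-integrable `]a, c[ (EFin \o f) -> mu.-integrable `]c, b[ (EFin \o g) ->
  mu.-integrable `]a, b[ (EFin \o (fun s => if s < c then f s else g s)).
Proof.
move=> ac cb if_ /integrable_itv_cc ig.
(* The test [s < c] hands the point [c] to [g]; the glued function is then the sum of the extensions
   by zero from []a, c[] and [[c, b[]. *)
have {}ig : mu.-integrable `[c, b[ (EFin \o g).
  by apply: integrableS ig => //; apply: subset_itv; rewrite bnd_simp.
move: if_ ig; rewrite integrable_mkcond// => if_.
rewrite integrable_mkcond// => ig.
apply: (@eq_integrable _ _ _ mu `]a, b[ (measurable_itv _)
  (fun s => ((EFin \o f) \_ `]a, c[) s + ((EFin \o g) \_ `[c, b[) s)%E).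
  move=> s /[!inE]/=; rewrite in_itv/= => /andP[as_ sb].
  rewrite !patchE; have [sc|cs] := ltP s c.
    rewrite mem_set/= ?in_itv/= ?as_// memNset/= ?in_itv/= ?leNgt ?sc//.
    by rewrite adde0.
  rewrite [X in _ + X]ifT/=; last by rewrite mem_set//= in_itv/= cs.
  by rewrite memNset/= ?in_itv/= ?ltNge ?cs ?andbF// add0e.
by apply: integrableD => //; [apply: integrableS if_|apply: integrableS ig].
Qed.

Lemma Rintegral_if a b c (f g : R -> R) : a <= c -> c <= b ->
  mu.-integrable `]a, c[ (EFin \o f) -> mu.-integrable `]c, b[ (EFin \o g) ->
  \int[mu]_(s in `]a, b[) (if s < c then f s else g s) =
  \int[mu]_(s in `]a, c[) f s + \int[mu]_(s in `]c, b[) g s.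
Proof.
move=> ac cb if_ ig.
rewrite (Rintegral_itv_split ac cb) ?integrable_if//; congr (_ + _).
  by apply: eq_Rintegral => s /[!inE]/=; rewrite in_itv/= => /andP[_ ->].
apply: eq_Rintegral => s /[!inE]/=; rewrite in_itv/= => /andP[cs _].
by rewrite ltNge ltW.
Qed.

Lemma ae_neq c : {ae mu, forall t, t != c}.
Proof.
have c0 : mu.-negligible [set c].
  by apply/negligibleP; [exact: measurable_set1|exact: lebesgue_measure_set1].
by apply: negligibleS c0 => t /= /negP; rewrite negbK => /eqP.
Qed.

End RealIntegrable.

(** * Primitives of integrable functions and their derivatives *)

Section Primitives.
Set Implicit Arguments.
Unset Strict Implicit.
Context {R : realType}.
Notation mu := (@lebesgue_measure R).
Implicit Types (a b t : R) (f g F : R -> R).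

Lemma ae_is_derive_Rintegral a b g : mu.-integrable `]a, b[ (EFin \o g) ->
  {ae mu, forall t, t \in `]a, b[ ->
    is_derive t (1 : R) (fun s : R => \int[mu]_(r in `]a, s[) g r) (g t)}.
Proof.
(* Lebesgue differentiation is applied to the extension [h] of [g] by zero, which is integrable on
   the whole line; for s near an interior point both have the same integral over []a, s[]. *)
move=> ig; have lh := integrable_locally (measurable_itv _) ig.
set h := (g \_ `]a, b[) in lh.
have ih : mu.-integrable setT (EFin \o h).
  by move: ig; rewrite integrable_mkcond// restrict_EFin.
have := lebesgue_differentiation lh; apply: filterS => [|t ht].
  exact: (ae_filter_ringOfSetsType mu).
rewrite in_itv/= => /andP[at_ tb].
have [||] := @FTC1_lebesgue_pt _ h (BRight a) t b tb _ _ ht.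
- by apply: integrableS ih.
- by rewrite lte_fin.
move=> dF eF; have {}dF := DeriveDef dF erefl.
rewrite -derive1E eF in dF.
have -> : g t = h t by rewrite /h patchE mem_set//= in_itv/= at_ tb.
apply: near_eq_is_derive dF; near=> s.
have sb : s < b by near: s; exact: lt_nbhsl.
have igs : mu.-integrable `]a, s[ (EFin \o g).
  apply: integrableS ig => //.
  by apply: subset_itv; rewrite bnd_simp// ltW.
rewrite [RHS](@Rintegral_itv_bndo_bndc _ (BRight a))//.
apply: eq_Rintegral => r /[!inE]/=; rewrite in_itv/= => /andP[ar rs].
by rewrite /h patchE mem_set//= in_itv/= ar (le_lt_trans rs).
Unshelve. all: by end_near. Qed.

Lemma Rintegral_within_continuous a b g :
  mu.-integrable `]a, b[ (EFin \o g) ->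
  {within `[a, b], continuous (fun s => \int[mu]_(r in `]a, s[) g r)}.
Proof.
move=> ig; have [ab|ba] := leP a b; last first.
  rewrite set_itv_ge ?bnd_simp -?ltNge//.
  exact: continuous_subspace0.
have := parameterized_integral_continuous ab (integrable_itv_cc ig).
apply: subspace_eq_continuous => s /[!inE]/=; rewrite in_itv/= => /andP[_ sb].
rewrite /from_subspace /= /parameterized_integral Rintegral_itv_cc//.
by apply: integrableS ig => //; apply: subset_itv; rewrite bnd_simp.
Qed.

(** One component of [abs_continuous], with the integrand made explicit. *)
Definition primitive a b F g :=
  mu.-integrable `]a, b[ (EFin \o g) /\
  forall t, a <= t <= b -> F t = F a + \int[mu]_(s in `]a, t[) g s.

Lemma primitive_continuous a b F g : primitive a b F g ->
  {within `[a, b], continuous F}.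
Proof.
move=> [ig FE].
have : {within `[a, b],
    continuous (fun t => F a + \int[mu]_(s in `]a, t[) g s)}.
  move=> t; apply: cvgD; first exact: cvg_cst.
  exact: Rintegral_within_continuous.
by apply: subspace_eq_continuous => s /[!inE]/=; rewrite in_itv/= => /FE.
Qed.

Lemma primitive_near a b F g t : primitive a b F g -> t \in `]a, b[ ->
  \forall s \near t, F a + \int[mu]_(r in `]a, s[) g r = F s.
Proof.
move=> [_ FE]; rewrite in_itv/= => /andP[at_ tb]; near=> s.
apply/esym/FE/andP; split; apply/ltW.
  by near: s; exact: lt_nbhsr.
by near: s; exact: lt_nbhsl.
Unshelve. all: by end_near. Qed.

Lemma primitive_ae_is_derive a b F g : primitive a b F g ->
  {ae mu, forall t, t \in `]a, b[ -> is_derive t (1 : R) F (g t)}.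
Proof.
move=> pF; have := ae_is_derive_Rintegral pF.1; apply: filterS => [|t dt tab].
  exact: (ae_filter_ringOfSetsType mu).
apply: near_eq_is_derive (primitive_near pF tab) _.
by rewrite -[g t]add0r; apply: is_deriveD; exact: dt.
Qed.

(** At almost every point both functions are the derivative of [F]. *)
Lemma primitive_ae_unique a b F g f : primitive a b F g ->
  {ae mu, forall t, t \in `]a, b[ -> is_derive t (1 : R) F (f t)} ->
  {ae mu, forall t, t \in `]a, b[ -> g t = f t}.
Proof.
move=> /primitive_ae_is_derive; apply: filterS2 => [|t dg df tab].
  exact: (ae_filter_ringOfSetsType mu).
by have [_ <-] := dg tab; have [_ <-] := df tab.
Qed.

(** Since [g] and [f] agree almost everywhere, [F] is also an integral of the continuous [f], and
    the fundamental theorem of calculus then applies at every interior point. *)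
Lemma primitive_is_derive a b F g f : a < b -> primitive a b F g ->
  {ae mu, forall t, t \in `]a, b[ -> is_derive t (1 : R) F (f t)} ->
  {within `[a, b], continuous f} ->
  forall t, t \in `]a, b[ -> is_derive t (1 : R) F (f t).
Proof.
move=> ab pF df cf t tab; have gf := primitive_ae_unique pF df.
have if_ := integrable_within_continuous cf.
have if' := integrable_itv_cc if_.
have [tl tr] : a < t /\ t < b by move: tab; rewrite in_itv/= => /andP.
have [|dF eF] := @continuous_FTC1_closed _ f a t b tr if' tl.
  exact: within_continuous_continuous tab.
have {}dF := DeriveDef dF erefl.
rewrite -derive1E eF in dF.
have {}dF : is_derive t (1 : R)
    (fun s => F a + \int[mu]_(r in `[a, s]) f r) (f t).
  by rewrite -[f t]add0r; apply: is_deriveD.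
apply: near_eq_is_derive dF; near=> s.
rewrite -(near (primitive_near pF tab) s)//; congr (_ + _).
have sb : s < b by near: s; exact: lt_nbhsl.
have sub : `]a, s[ `<=` `]a, b[ by apply: subset_itv; rewrite bnd_simp// ltW.
rewrite -Rintegral_itv_cc; last exact: integrableS if_.
congr fine; apply: ae_eq_integral => //.
- by apply: (@measurable_int _ _ _ mu); exact: integrableS if_.
- by apply: (@measurable_int _ _ _ mu); apply: integrableS pF.1.
- apply: filterS gf => [|r gfr ras]; first exact: (ae_filter_ringOfSetsType mu).
  rewrite gfr//; exact: sub.
Unshelve. all: by end_near. Qed.

Lemma is_derive_primitive a b F f :
  {within `[a, b], continuous F} -> {within `[a, b], continuous f} ->
  (forall t, t \in `]a, b[ -> is_derive t (1 : R) F (f t)) ->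
  primitive a b F f.
Proof.
move=> cF cf dF; split; first exact: integrable_within_continuous.
(* The case [t = a] is separate: the fundamental theorem needs a nondegenerate interval. *)
move=> t /andP[]; rewrite le_eqVlt => /predU1P[<- _|at_ tb].
  by rewrite set_itv_ge ?bnd_simp ?ltxx// Rintegral_set0 addr0.
have sub : `[a, t] `<=` `[a, b] by apply: subset_itv; rewrite bnd_simp.
have {}cF := continuous_subspaceW sub cF.
have {}cf := continuous_subspaceW sub cf.
have {}dF s : s \in `]a, t[ -> is_derive s (1 : R) F (f s).
  move=> /[!in_itv]/= /andP[as_ st]; apply: dF; rewrite in_itv/= as_/=.
  exact: lt_le_trans tb.
rewrite Rintegral_itv_cc; last exact: integrable_within_continuous.
rewrite /Rintegral (continuous_FTC2 at_ cf (F := F)) /=.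
- by rewrite subrKC.
- have [_ ca ct] := (continuous_within_itvP F at_).1 cF.
  by split => // s /dF [].
- by move=> s /dF [_ <-]; rewrite derive1E.
Qed.

Lemma primitiveW a b c F g : a <= c -> c <= b -> primitive a b F g ->
  primitive c b F g.
Proof.
move=> ac cb [ig FE]; split.
  by apply: integrableS ig => //; apply: subset_itv; rewrite bnd_simp.
move=> t /andP[ct tb]; rewrite FE ?tb ?(le_trans ac)// (FE c) ?ac// -addrA.
congr (_ + _); apply: Rintegral_itv_split => //.
by apply: integrableS ig => //; apply: subset_itv; rewrite bnd_simp.
Qed.

Lemma primitiveD a b F G f g : primitive a b F f -> primitive a b G g ->
  primitive a b (fun s => F s + G s) (fun s => f s + g s).
Proof.
move=> [if_ FE] [ig GE]; split; first exact: integrable_addr.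
move=> t tab; have /andP[_ tb] := tab.
have sub : `]a, t[ `<=` `]a, b[ by apply: subset_itv; rewrite bnd_simp.
rewrite (FE _ tab) (GE _ tab) RintegralD.
- by rewrite addrACA.
- by [].
- exact: integrableS if_.
- exact: integrableS ig.
Qed.

Lemma primitiveZ a b F f (k : R) : primitive a b F f ->
  primitive a b (fun s => k * F s) (fun s => k * f s).
Proof.
move=> [if_ FE]; split; first exact: integrable_scaler.
move=> t tab; have /andP[_ tb] := tab.
have sub : `]a, t[ `<=` `]a, b[ by apply: subset_itv; rewrite bnd_simp.
rewrite FE// mulrDr RintegralZl//; exact: integrableS if_.
Qed.

Lemma primitive_if a b c (F f G g : R -> R) : a <= c -> c <= b ->
  F c = G c -> primitive a b F f -> primitive c b G g ->
  primitive a b (fun s => if s < c then F s else G s)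
                (fun s => if s < c then f s else g s).
Proof.
move=> ac cb FG [if_ FE] [ig GE].
have {}if_ x : x <= c -> mu.-integrable `]a, x[ (EFin \o f).
  move=> xc; apply: integrableS if_ => //.
  by apply: subset_itv; rewrite bnd_simp// (le_trans xc).
split; first by apply: integrable_if => //; exact: if_.
move=> t /andP[at_ tb].
(* At [a] the test fails only if [a = c], where the two branches have the same value. *)
have Fa : (if a < c then F a else G a) = F a.
  by case: ltP => // ca; have -> : a = c by lra.
rewrite Fa; have [tc|ct] := ltP t c.
  rewrite FE ?at_//; congr (_ + _); apply: eq_Rintegral => s /[!inE]/=.
  by rewrite in_itv/= => /andP[_ st]; rewrite (lt_trans st).
rewrite Rintegral_if//; last 2 first.
- exact: if_.
- by apply: integrableS ig => //; apply: subset_itv; rewrite bnd_simp.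
by rewrite addrA -FE ?ac// FG GE// ct.
Qed.

(** The constant 0 is then a primitive of [w], and almost everywhere [w] is its derivative. *)
Lemma ae_zero_of_Rintegral a b (w : R -> R) :
  mu.-integrable `]a, b[ (EFin \o w) ->
  (forall t, a <= t <= b -> \int[mu]_(s in `]a, t[) w s = 0) ->
  {ae mu, forall t, t \in `]a, b[ -> w t = 0}.
Proof.
move=> iw w0.
have pw : primitive a b (cst 0) w.
  by split=> // t tab; rewrite w0// addr0.
by apply: (primitive_ae_unique pw); apply: aeW => t _; exact: is_derive_cst.
Qed.

End Primitives.

(** * Differential equations *)

Section LinearODE.
Set Implicit Arguments.
Unset Strict Implicit.
Context {R : realType}.
Notation mu := (@lebesgue_measure R).
Implicit Types (a b c t : R).

Lemma abs_continuous_primitive k a b (z : R -> 'cV[R]_k) :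
  abs_continuous a b z <-> exists g : R -> 'cV[R]_k,
    forall i, primitive a b (fun s => z s i ord0) (fun s => g s i ord0).
Proof. by []. Qed.

Lemma ode_mxcont k a b (z f : R -> 'cV[R]_k) : ode a b z f ->
  mxcont `[a, b] z.
Proof.
by move=> [[g zg] _] i j; rewrite (ord1 j); exact: primitive_continuous (zg i).
Qed.

(** A Caratheodory solution with continuous right-hand side is a classical one. This applies to the
    costate, whose equation does not contain the control. *)
Lemma ode_mxderiv k a b (z f : R -> 'cV[R]_k) : a < b -> ode a b z f ->
  mxcont `[a, b] f -> forall t, t \in `]a, b[ -> mxderiv t z (f t).
Proof.
move=> ab [[g zg] dz] cf t tab i j; rewrite (ord1 j).
apply: (primitive_is_derive ab (zg i) (f := fun s => f s i ord0)) => //.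
by apply: filterS dz => [|s /[apply]//]; exact: (ae_filter_ringOfSetsType mu).
Qed.

Lemma mxderiv_ode k a b (z f : R -> 'cV[R]_k) :
  mxcont `[a, b] z -> mxcont `[a, b] f ->
  (forall t, t \in `]a, b[ -> mxderiv t z (f t)) -> ode a b z f.
Proof.
move=> cz cf dz; split.
  exists f => i; apply: is_derive_primitive => // t tab; exact: dz.
by apply: aeW => t tab i; exact: dz.
Qed.

Lemma odeW k a b c (z f : R -> 'cV[R]_k) : a <= c -> c <= b ->
  ode a b z f -> ode c b z f.
Proof.
move=> ac cb [[g zg] dz]; split.
  by exists g => i; exact: primitiveW (zg i).
apply: filterS dz => [|s dz]; first exact: (ae_filter_ringOfSetsType mu).
move=> /[!in_itv]/= /andP[cs sb]; apply: dz.
by rewrite in_itv/= sb (le_lt_trans ac).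
Qed.

Lemma odeD k a b (e : R) (z f w h : R -> 'cV[R]_k) :
  ode a b z f -> ode a b w h ->
  ode a b (fun s => z s + e *: w s) (fun s => f s + e *: h s).
Proof.
move=> [[g zg] dz] [[g' wg] dw].
have E (p q : R -> 'cV[R]_k) i : (fun s => (p s + e *: q s) i ord0) =
    (fun s => p s i ord0 + e * q s i ord0).
  by apply/funext => s; rewrite !mxE.
split.
  apply/abs_continuous_primitive.
  exists (fun s => g s + e *: g' s) => i; rewrite !E.
  exact: (primitiveD (zg i) (primitiveZ e (wg i))).
apply: filterS2 dz dw => [|s dz dw sab i].
  exact: (ae_filter_ringOfSetsType mu).
rewrite E !mxE; apply: is_deriveD; first exact: dz.
by apply: is_deriveZ; exact: dw.
Qed.

Lemma ode_if k a b c (z f w h : R -> 'cV[R]_k) : a <= c -> c <= b ->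
  z c = w c -> ode a b z f -> ode c b w h ->
  ode a b (fun s => if s < c then z s else w s)
          (fun s => if s < c then f s else h s).
Proof.
move=> ac cb zw [[g zg] dz] [[g' wg] dw].
have E (p q : R -> 'cV[R]_k) i :
    (fun s => (if s < c then p s else q s) i ord0) =
    (fun s => if s < c then p s i ord0 else q s i ord0).
  by apply/funext => s; case: ifP.
split.
  apply/abs_continuous_primitive.
  exists (fun s => if s < c then g s else g' s) => i; rewrite !E.
  apply: (primitive_if ac cb _ (zg i) (wg i)).
  by rewrite zw.
(* The one-sided derivatives may differ at the junction [c], a null set that is discarded. Any other
   point has a neighbourhood on which a single branch is active. *)
have := ae_neq c; apply: filterS3 dz dw => [|s dz dw sc sab i].
  exact: (ae_filter_ringOfSetsType mu).
rewrite E; have [{}sc|cs] := ltP s c.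
  apply: near_eq_is_derive (dz sab i); near=> r.
  by rewrite ifT//; near: r; exact: lt_nbhsl.
have {cs}sc : c < s by rewrite lt_neqAle eq_sym sc.
have scb : s \in `]c, b[ by move: sab; rewrite !in_itv/= sc => /andP[_ ->].
apply: near_eq_is_derive (dw scb i); near=> r.
rewrite ifF//; apply/negbTE; rewrite -leNgt; apply: ltW.
by near: r; exact: lt_nbhsr.
Unshelve. all: by end_near. Qed.

Lemma mxcont_opp_expmx n (M : 'M[R]_n) D : mxcont D (fun s => expmx M (- s)).
Proof.
have dN s : mxderiv s (fun s => expmx M (- s)) (- (M *m expmx M (- s))).
  exact: mxderiv_expmxN.
exact: mxderiv_mxcont dN.
Qed.

(** Variation of constants: z(t) = exp(tM) (k + H(t)), where H is the integral of exp(-sM) f(s) from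
    a. The base point [t0] is free because variations of the state start at the left end while the
    costate is prescribed at the right end. *)
Lemma linear_ode_exists n (M : 'M[R]_n) a b t0 (f : R -> 'cV[R]_n)
    (z0 : 'cV[R]_n) :
  a < b -> t0 \in `[a, b] -> mxcont `[a, b] f ->
  exists z, [/\ z t0 = z0, mxcont `[a, b] z &
    forall t, t \in `]a, b[ -> mxderiv t z (M *m z t + f t)].
Proof.
move=> ab t0ab cf.
pose h s : 'cV[R]_n := expmx M (- s) *m f s.
have ch : mxcont `[a, b] h by apply: mxcontM => //; exact: mxcont_opp_expmx.
pose H s : 'cV[R]_n := \col_i \int[mu]_(r in `[a, s]) h r i ord0.
have ih i : mu.-integrable `[a, b] (EFin \o (fun r => h r i ord0)).
  by apply: integrable_itv_cc; exact: integrable_within_continuous.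
have cH : mxcont `[a, b] H.
  move=> i j; rewrite (_ : (fun s : R => _) =
      fun s => parameterized_integral mu a s (fun r => h r i ord0)).
    by apply: parameterized_integral_continuous => //; exact: ltW.
  by apply/funext => s; rewrite mxE.
have dH t : t \in `]a, b[ -> mxderiv t H (h t).
  move=> tab i j; rewrite (ord1 j).
  rewrite (_ : (fun s : R => _) = fun s => \int[mu]_(r in `[a, s]) h r i ord0).
    have [at_ tb] : a < t /\ t < b by move: tab; rewrite in_itv/= => /andP.
    have [|dF eF] := @continuous_FTC1_closed _ _ a t b tb (ih i) at_.
      exact: within_continuous_continuous tab.
    by have := DeriveDef dF erefl; rewrite -derive1E eF.
  by apply/funext => s; rewrite mxE.
(* This constant makes the bracket equal to exp(-t0 M) z0 at [t0]. *)
pose k := expmx M (- t0) *m z0 - H t0.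
exists (fun t => expmx M t *m (k + H t)); split.
- by rewrite /k subrK mulmxA expmx_cancel mul1mx.
- apply: mxcontM; first by apply: mxderiv_mxcont; exact: mxderiv_expmx.
  by apply: mxcontD => //; exact: mxcont_cst.
move=> t tab.
have := mxderivM (mxderiv_expmx M t) (mxderivD (mxderiv_cst t k) (dH t tab)).
by rewrite add0r /h [X in _ + X]mulmxA expmx_cancel mul1mx -mulmxA.
Qed.

(** The function exp(-sM) z(s) has zero derivative, hence is constant by the mean value theorem, and
    it vanishes at [a]; the exponential is invertible. *)
Lemma linear_ode_unique n (M : 'M[R]_n) a b (z : R -> 'cV[R]_n) :
  mxcont `[a, b] z -> (forall t, t \in `]a, b[ -> mxderiv t z (M *m z t)) ->
  z a = 0 -> forall t, t \in `[a, b] -> z t = 0.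
Proof.
move=> cz dz za t; rewrite in_itv/= => /andP[].
rewrite le_eqVlt => /predU1P[<-//|at_ tb].
pose w s : 'cV[R]_n := expmx M (- s) *m z s.
have dw s : s \in `]a, t[ -> mxderiv s w 0.
  move=> /[!in_itv]/= /andP[as_ st].
  have sab : s \in `]a, b[ by rewrite in_itv/= as_ (lt_le_trans st).
  have := mxderivM (mxderiv_expmxN M s) (dz s sab).
  by rewrite mulNmx mulmxA comm_expmx addNr.
have cw : mxcont `[a, t] w.
  apply: mxcontM; first exact: mxcont_opp_expmx.
  move=> i j; apply: continuous_subspaceW (cz i j).
  by apply: subset_itv; rewrite bnd_simp.
have w0 : w t = 0.
  apply/matrixP => i j.
  have [] := @MVT _ (fun s => w s i j) (fun=> 0) a t at_.
  - by move=> s /dw /(_ i j); rewrite mxE.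
  - exact: cw.
  by move=> _ _ /eqP; rewrite mul0r subr_eq0 /w za mulmx0 => /eqP ->.
have : expmx M t *m w t = 0 by rewrite w0 mulmx0.
by rewrite /w mulmxA expmx_cancel mul1mx.
Qed.

End LinearODE.

(** * The linear-quadratic problem *)

Section Dot.
Set Implicit Arguments.
Unset Strict Implicit.
Context {R : realType}.

Lemma dotE k (v w : 'cV[R]_k) : dot v w = (v^T *m w) ord0 ord0.
Proof. by rewrite mxE; apply: eq_bigr => i _; rewrite mxE. Qed.

Lemma dotC k (v w : 'cV[R]_k) : dot v w = dot w v.
Proof. by apply: eq_bigr => i _; rewrite mulrC. Qed.

Lemma dotDr k (v w w' : 'cV[R]_k) : dot v (w + w') = dot v w + dot v w'.
Proof. by rewrite !dotE mulmxDr mxE. Qed.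

Lemma dotDl k (v w w' : 'cV[R]_k) : dot (w + w') v = dot w v + dot w' v.
Proof. by rewrite dotC dotDr !(dotC v). Qed.

Lemma dotZr k c (v w : 'cV[R]_k) : dot v (c *: w) = c * dot v w.
Proof. by rewrite !dotE -scalemxAr mxE. Qed.

Lemma dotZl k c (v w : 'cV[R]_k) : dot (c *: w) v = c * dot w v.
Proof. by rewrite dotC dotZr dotC. Qed.

Lemma dotNl k (v w : 'cV[R]_k) : dot (- w) v = - dot w v.
Proof. by rewrite -scaleN1r dotZl mulN1r. Qed.

Lemma dot0r k (v : 'cV[R]_k) : dot v 0 = 0.
Proof. by rewrite -(scale0r 0) dotZr mul0r. Qed.

Lemma dot_mulmxl j k (M : 'M[R]_(j, k)) v w : dot (M *m v) w = dot v (M^T *m w).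
Proof. by rewrite !dotE trmx_mul mulmxA. Qed.

Lemma dot_deltar k (v : 'cV[R]_k) i : dot v (delta_mx i ord0) = v i ord0.
Proof.
rewrite /dot (bigD1 i)//= big1 ?addr0 ?mxE ?eqxx ?mulr1//.
by move=> j ji; rewrite mxE (negbTE ji) mulr0.
Qed.

Lemma dot_inj k (v w : 'cV[R]_k) : (forall z, dot v z = dot w z) -> v = w.
Proof.
by move=> vw; apply/matrixP => i j; rewrite (ord1 j) -!dot_deltar vw.
Qed.

Lemma dot_ge0 k (v : 'cV[R]_k) : 0 <= dot v v.
Proof. by rewrite sumr_ge0// => i _; rewrite -expr2 sqr_ge0. Qed.

Lemma enorm_sqr k (v : 'cV[R]_k) : enorm v ^+ 2 = dot v v.
Proof. by rewrite sqr_sqrtr// dot_ge0. Qed.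

Lemma continuous_dot k D (f g : R -> 'cV[R]_k) : mxcont D f -> mxcont D g ->
  {within D, continuous (fun s => dot (f s) (g s))}.
Proof.
move=> cf cg.
rewrite (_ : (fun s : R => _) = fun s => ((f s)^T *m g s) ord0 ord0).
  by apply: mxcontM => //; exact: mxcont_tr.
by apply/funext => s; rewrite dotE.
Qed.

Lemma is_derive_dot k t (f g : R -> 'cV[R]_k) f' g' :
  mxderiv t f f' -> mxderiv t g g' ->
  is_derive t (1 : R) (fun s : R => dot (f s) (g s))
    (dot f' (g t) + dot (f t) g').
Proof.
move=> df dg.
rewrite (_ : (fun s : R => _) = fun s => ((f s)^T *m g s) ord0 ord0).
  have /(_ ord0 ord0) := mxderivM (mxderiv_tr df) dg.
  by rewrite mxE -!dotE.
by apply/funext => s; rewrite dotE.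
Qed.

Lemma quadratic_tangent (l1 l2 q1 q2 : R) :
  (forall e, 2 * e * l1 + e ^+ 2 * q1 <= 2 * e * l2 + e ^+ 2 * q2) -> l1 = l2.
Proof.
move=> h; apply/eqP; rewrite -subr_eq0 -sqrf_eq0; apply/eqP.
(* Taking [e = d / K] and multiplying by K^2 gives 2 d^2 K <= d^2 (q2 - q1) <= d^2 (K - 1), which
   forces d = 0. *)
set d := l1 - l2; pose K := `|q2 - q1| + 1.
have K0 : 0 < K by rewrite ltr_wpDl.
have qK : q2 - q1 <= K - 1 by rewrite /K addrK ler_norm.
have := h (d / K).
have -> : l1 = l2 + d by rewrite /d; ring.
move=> {}h; have {}h : 2 * d ^+ 2 * K <= d ^+ 2 * (q2 - q1).
  rewrite -subr_le0; have := ler_wpM2r (sqr_ge0 K) h; rewrite -subr_le0.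
  apply: le_trans; rewrite le_eqVlt; apply/orP; left; apply/eqP.
  by field; rewrite gt_eqF.
have := sqr_ge0 d; nra.
Qed.

End Dot.

(** * Integrability of the cost, its quadratic expansion and the adjoint identity *)

Section LinearQuadratic.
Set Implicit Arguments.
Unset Strict Implicit.
Context {R : realType} {n m p : nat}.
Notation mu := (@lebesgue_measure R).
Variables (A : 'M[R]_n) (B : 'M[R]_(n, p)) (C : 'M[R]_(m, n)) (P0 : 'M[R]_n).
Implicit Types (a b : R) (u : R -> 'cV[R]_p) (x z : R -> 'cV[R]_n).

Lemma L2_integrable k a b (u : R -> 'cV[R]_k) : L2 a b u ->
  (forall i, mu.-integrable `]a, b[ (EFin \o (fun s => u s i ord0))) /\
  mu.-integrable `]a, b[ (EFin \o (fun s => dot (u s) (u s))).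
Proof.
move=> [mu_ iu].
have md : measurable_fun `]a, b[ (fun s => dot (u s) (u s)).
  apply: measurable_sum => i; apply: measurable_funM; exact: mu_.
have id_ : mu.-integrable `]a, b[ (EFin \o (fun s => dot (u s) (u s))).
  apply/integrableP; split; first exact/measurable_EFinP.
  apply: le_lt_trans iu; rewrite le_eqVlt; apply/orP; left; apply/eqP.
  by apply: eq_integral => s _; rewrite /= enorm_sqr ger0_norm// dot_ge0.
split=> // i.
(* On a bounded interval square-integrable functions are integrable: each |u_i| is at most 1 +
   |u|^2. *)
have i1 : mu.-integrable `]a, b[ (EFin \o (fun s => 1 + dot (u s) (u s))).
  apply: integrable_addr => //; apply: integrable_within_continuous => s.
  exact: cvg_cst.
apply: le_integrable i1 => //.
  by apply/measurable_EFinP; exact: mu_.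
move=> s _; rewrite /= lee_fin [leRHS]ger0_norm ?addr_ge0 ?dot_ge0//.
have ui : u s i ord0 ^+ 2 <= dot (u s) (u s).
  rewrite /dot (bigD1 i)//= -expr2 lerDl sumr_ge0// => j _.
  by rewrite -expr2 sqr_ge0.
rewrite -real_normK ?num_real// in ui.
have := sqr_ge0 (`|u s i ord0| - 1 / 2); move: ui; set q := `|_|; nra.
Qed.

Lemma integrable_L2 k a b (u : R -> 'cV[R]_k) :
  (forall i, mu.-integrable `]a, b[ (EFin \o (fun s => u s i ord0))) ->
  mu.-integrable `]a, b[ (EFin \o (fun s => dot (u s) (u s))) ->
  L2 a b u.
Proof.
move=> iu id_; split.
  by move=> i; apply/measurable_EFinP; exact: (measurable_int mu (iu i)).
under eq_integral do rewrite enorm_sqr.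
exact: integrable_lty id_.
Qed.

Lemma integrable_dot_cst k a b (u : R -> 'cV[R]_k) v :
  (forall i, mu.-integrable `]a, b[ (EFin \o (fun s => u s i ord0))) ->
  mu.-integrable `]a, b[ (EFin \o (fun s => dot (u s) v)).
Proof.
move=> iu; apply: integrable_sumr => i.
rewrite (_ : (fun s : R => _) = fun s => v i ord0 * u s i ord0).
  exact: integrable_scaler.
by apply/funext => s; rewrite mulrC.
Qed.

Definition running_cost u x (s : R) : R :=
  dot (C *m x s) (C *m x s) + dot (u s) (u s).

(** Real-valued counterpart of [cost], suited to algebra; [costE] identifies the two for
    square-integrable controls and continuous trajectories. *)
Definition real_cost a b u x : R :=
  \int[mu]_(s in `]a, b[) running_cost u x s + dot (P0 *m x b) (x b).

Lemma integrable_running_cost a b u x : L2 a b u -> mxcont `[a, b] x ->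
  mu.-integrable `]a, b[ (EFin \o running_cost u x).
Proof.
move=> /L2_integrable[_ iu] cx; apply: integrable_addr => //.
apply: integrable_within_continuous.
by apply: continuous_dot; exact: mxcont_mulcl.
Qed.

Lemma costE a b u x : L2 a b u -> mxcont `[a, b] x ->
  cost C P0 a b u x = (real_cost a b u x)%:E.
Proof.
move=> Lu cx; rewrite /cost /real_cost EFinD; congr (_ + _)%E.
rewrite /Rintegral fineK; last first.
  by apply: integrable_fin_num => //; exact: integrable_running_cost.
by apply: eq_integral => s _; rewrite !enorm_sqr.
Qed.

Lemma L2_perturb a b u v (e : R) : L2 a b u -> L2 a b (fun s => u s + e *: v).
Proof.
move=> /L2_integrable[iu id_]; apply: integrable_L2 => [i|].
  rewrite (_ : (fun s : R => _) = fun s => u s i ord0 + e * v i ord0).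
    apply: integrable_addr => //; apply: integrable_within_continuous => s.
    exact: cvg_cst.
  by apply/funext => s; rewrite !mxE.
rewrite (_ : (fun s : R => _) = fun s => dot (u s) (u s) +
    (2 * e * dot (u s) v + e ^+ 2 * dot v v)).
  apply: integrable_addr => //; apply: integrable_addr => //.
    by apply: integrable_scaler => //; exact: integrable_dot_cst.
  by apply: integrable_within_continuous => s; exact: cvg_cst.
apply/funext => s; rewrite !(dotDl, dotDr, dotZl, dotZr) (dotC v).
by ring.
Qed.

(** The expansion is exact because the cost is quadratic: the bracket after [2 * e] is half the
    first variation, and the coefficient of [e ^+ 2] is the cost of the direction itself. *)
Lemma real_cost_perturb a b u x v z (e : R) :
  P0^T = P0 -> L2 a b u -> mxcont `[a, b] x -> mxcont `[a, b] z ->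
  real_cost a b (fun s => u s + e *: v) (fun s => x s + e *: z s) =
  real_cost a b u x +
  2 * e * (\int[mu]_(s in `]a, b[) (dot (C *m x s) (C *m z s) + dot (u s) v) +
           dot (P0 *m x b) (z b)) +
  e ^+ 2 * real_cost a b (fun=> v) z.
Proof.
move=> P0_sym Lu cx cz; have [iu _] := L2_integrable Lu.
have ic := integrable_running_cost Lu cx.
have icz : mu.-integrable `]a, b[ (EFin \o running_cost (fun=> v) z).
  apply: integrable_within_continuous => s; apply: cvgD; last exact: cvg_cst.
  by apply: continuous_dot; exact: mxcont_mulcl.
have il : mu.-integrable `]a, b[
    (EFin \o (fun s => dot (C *m x s) (C *m z s) + dot (u s) v)).
  apply: integrable_addr => //; last exact: integrable_dot_cst.
  apply: integrable_within_continuous.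
  by apply: continuous_dot; exact: mxcont_mulcl.
rewrite /real_cost.
rewrite (@eq_Rintegral _ _ _ mu _ (fun s => running_cost u x s +
  (2 * e * (dot (C *m x s) (C *m z s) + dot (u s) v) +
   e ^+ 2 * running_cost (fun=> v) z s))); last first.
  move=> s _; rewrite /running_cost !(mulmxDr, dotDl, dotDr) -!scalemxAr.
  by rewrite !(dotZl, dotZr) (dotC v) (dotC (C *m z s) (C *m x s)); ring.
rewrite (Rintegral_linear _ _ ic il icz) !(mulmxDr, dotDl, dotDr).
rewrite -!scalemxAr !(dotZl, dotZr).
(* Symmetry of [P0] merges the two cross terms at the final time. *)
by rewrite (dot_mulmxl _ (z b) (x b)) P0_sym (dotC (z b)); ring.
Qed.

(* The costate turns the first variation of the cost into boundary data. *)
Lemma adjoint_identity a b x y z v : a < b ->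
  mxcont `[a, b] x -> mxcont `[a, b] y -> mxcont `[a, b] z ->
  (forall t, t \in `]a, b[ -> mxderiv t y (- (A^T *m y t) - C^T *m C *m x t)) ->
  (forall t, t \in `]a, b[ -> mxderiv t z (A *m z t + B *m v)) ->
  dot (y b) (z b) + \int[mu]_(s in `]a, b[) dot (C *m x s) (C *m z s) =
  dot (y a) (z a) + \int[mu]_(s in `]a, b[) dot (B^T *m y s) v.
Proof.
move=> ab cx cy cz dy dz.
have c1 : {within `[a, b], continuous (fun s => dot (C *m x s) (C *m z s))}.
  by apply: continuous_dot; exact: mxcont_mulcl.
have c2 : {within `[a, b], continuous (fun s => dot (B^T *m y s) v)}.
  by apply: continuous_dot; [exact: mxcont_mulcl|exact: mxcont_cst].
have i1 := integrable_within_continuous c1.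
have i2 := integrable_within_continuous c2.
(* In the derivative of <y, z> the terms containing [A] cancel between the costate and state
   equations. *)
have [_] : primitive a b (fun s => dot (y s) (z s))
   (fun s => dot (B^T *m y s) v + -1 * dot (C *m x s) (C *m z s)).
  apply: is_derive_primitive.
  - exact: continuous_dot.
  - move=> s; apply: cvgD; first exact: c2.
    by apply: cvgM; [exact: cvg_cst|exact: c1].
  - move=> t tab; apply: is_derive_eq (is_derive_dot (dy t tab) (dz t tab)) _.
    by rewrite dotDl !dotNl dotDr -mulmxA !dot_mulmxl !trmxK; ring.
move=> /(_ b); rewrite (ltW ab) lexx => ->//.
rewrite RintegralD//; last exact: integrable_scaler.
by rewrite RintegralZl//; ring.
Qed.

End LinearQuadratic.

(** * Dynamic programming and the gradient of the value function *)

Section OptimalControl.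
Set Implicit Arguments.
Unset Strict Implicit.
Context {R : realType} {n m p : nat}.
Notation mu := (@lebesgue_measure R).
Variables (A : 'M[R]_n) (B : 'M[R]_(n, p)) (C : 'M[R]_(m, n)) (P0 : 'M[R]_n).
Implicit Types (a b c t : R) (u : R -> 'cV[R]_p) (x y z : R -> 'cV[R]_n).

(** The control cancels in the difference of two trajectories, leaving a homogeneous equation with
    continuous right-hand side, to which classical uniqueness applies. *)
Lemma state_unique a b eta u x z : a < b ->
  state_eq A B a b eta u x -> state_eq A B a b eta u z ->
  forall t, t \in `[a, b] -> x t = z t.
Proof.
move=> ab [ox xa] [oz za].
pose w s := x s + -1 *: z s.
have ow : ode a b w (fun s => A *m w s).
  have -> : (fun s => A *m w s) =
      fun s => (A *m x s + B *m u s) + -1 *: (A *m z s + B *m u s).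
    apply/funext => s; rewrite /w mulmxDr -scalemxAr scalerDr !scaleN1r.
    by rewrite addrACA subrr addr0.
  exact: odeD.
have cw := ode_mxcont ow.
have cAw : mxcont `[a, b] (fun s => A *m w s).
  by exact: mxcont_mulcl.
have w0 : w a = 0 by rewrite /w xa za scaleN1r subrr.
move=> t tab; have := linear_ode_unique cw (ode_mxderiv ab ow cAw) w0 tab.
by move/eqP; rewrite /w scaleN1r subr_eq0 => /eqP.
Qed.

Lemma state_perturb a b eta u x z (v0 : 'cV[R]_p) (e : R) : mxcont `[a, b] z ->
  (forall t, t \in `]a, b[ -> mxderiv t z (A *m z t + B *m v0)) ->
  state_eq A B a b eta u x ->
  state_eq A B a b (eta + e *: z a) (fun s => u s + e *: v0)
    (fun s => x s + e *: z s).
Proof.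
move=> cz dz [ox <-]; split=> //.
have oz : ode a b z (fun s => A *m z s + B *m v0).
  apply: mxderiv_ode => //; apply: mxcontD; last exact: mxcont_cst.
  by exact: mxcont_mulcl.
have -> : (fun s => A *m (x s + e *: z s) + B *m (u s + e *: v0)) =
    fun s => (A *m x s + B *m u s) + e *: (A *m z s + B *m v0).
  by apply/funext => s; rewrite !mulmxDr -!scalemxAr scalerDr addrACA.
exact: odeD.
Qed.

Lemma optimal_value_le a b eta u x : L2 a b u -> state_eq A B a b eta u x ->
  (optimal_value A B C P0 a b eta <= (real_cost C P0 a b u x)%:E)%E.
Proof.
move=> Lu sx; apply: ereal_inf_lbound; exists u, x; split=> //.
by rewrite costE//; exact: ode_mxcont sx.1.
Qed.

Lemma optimal_valueP a b eta (c : R) :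
  (c%:E <= optimal_value A B C P0 a b eta)%E <->
  (forall u x, L2 a b u -> state_eq A B a b eta u x ->
    c <= real_cost C P0 a b u x).
Proof.
split=> [cV u x Lu sx|cV].
  by rewrite -lee_fin (le_trans cV)// optimal_value_le.
apply/ereal_infP => _ [u [x [Lu sx ->]]].
by rewrite costE ?lee_fin ?cV//; exact: ode_mxcont sx.1.
Qed.

Lemma L2W k a b c (u : R -> 'cV[R]_k) : a <= c -> L2 a b u -> L2 c b u.
Proof.
move=> ac /L2_integrable[iu id_].
have sub : `]c, b[ `<=` `]a, b[ by apply: subset_itv; rewrite bnd_simp.
apply: integrable_L2 => [i|]; last by apply: integrableS id_.
by apply: integrableS (iu i).
Qed.

Lemma L2_if k a b c (u v : R -> 'cV[R]_k) : a <= c -> c <= b ->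
  L2 a b u -> L2 c b v -> L2 a b (fun s => if s < c then u s else v s).
Proof.
move=> ac cb /L2_integrable[iu id_] /L2_integrable[iv jd].
have sub : `]a, c[ `<=` `]a, b[ by apply: subset_itv; rewrite bnd_simp.
apply: integrable_L2 => [i|].
  rewrite (_ : (fun s : R => _) =
      fun s => if s < c then u s i ord0 else v s i ord0).
    by apply: integrable_if => //; apply: integrableS (iu i).
  by apply/funext => s; case: ifP.
rewrite (_ : (fun s : R => _) =
    fun s => if s < c then dot (u s) (u s) else dot (v s) (v s)).
  by apply: integrable_if => //; apply: integrableS id_.
by apply/funext => s; case: ifP.
Qed.

Lemma state_if a b c eta u v x z : a <= c -> c <= b ->
  state_eq A B a b eta u x -> state_eq A B c b (x c) v z ->
  state_eq A B a b eta (fun s => if s < c then u s else v s)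
    (fun s => if s < c then x s else z s).
Proof.
move=> ac cb [ox xa] [oz zc]; split; last first.
  by case: ltP => // ca; rewrite -xa (_ : a = c) ?zc//; lra.
have -> : (fun s => A *m (if s < c then x s else z s) +
                    B *m (if s < c then u s else v s)) =
    fun s => if s < c then A *m x s + B *m u s else A *m z s + B *m v s.
  by apply/funext => s; case: ifP.
exact: (ode_if ac cb (esym zc) ox oz).
Qed.

Lemma real_cost_split a b c u x : a <= c -> c <= b -> L2 a b u ->
  mxcont `[a, b] x -> real_cost C P0 a b u x =
  \int[mu]_(s in `]a, c[) running_cost C u x s + real_cost C P0 c b u x.
Proof.
move=> ac cb Lu cx; rewrite /real_cost (Rintegral_itv_split ac cb) ?addrA//.
exact: integrable_running_cost.
Qed.

Lemma real_cost_if a b c u v x z : a <= c -> c < b -> L2 a b u ->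
  mxcont `[a, b] x -> L2 c b v -> mxcont `[c, b] z ->
  real_cost C P0 a b (fun s => if s < c then u s else v s)
    (fun s => if s < c then x s else z s) =
  \int[mu]_(s in `]a, c[) running_cost C u x s + real_cost C P0 c b v z.
Proof.
move=> ac cb Lu cx Lv cz; rewrite /real_cost [in x in dot x]ltNge (ltW cb)/=.
rewrite ifF; last by rewrite ltNge ltW.
rewrite addrA; congr (_ + _).
rewrite -Rintegral_if ?(ltW cb)//; last 2 first.
- apply: integrableS (integrable_running_cost C Lu cx) => //.
  by apply: subset_itv; rewrite bnd_simp// ltW.
- exact: integrable_running_cost.
by apply: eq_Rintegral => s _; rewrite /running_cost; case: ifP.
Qed.

(** A cheaper pair starting from [x c] could be glued to the head of [(u, x)] at time [c]; the
    running cost of the head is common to both sides, so the whole would beat the optimum. *)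
Lemma dynamic_programming a b c eta u x : a <= c -> c < b ->
  L2 a b u -> state_eq A B a b eta u x ->
  optimal_value A B C P0 a b eta = (real_cost C P0 a b u x)%:E ->
  optimal_value A B C P0 c b (x c) = (real_cost C P0 c b u x)%:E.
Proof.
move=> ac cb Lu sx opt; have cx := ode_mxcont sx.1.
apply/eqP; rewrite eq_le; apply/andP; split.
  apply: optimal_value_le; first exact: L2W Lu.
  by split => //; apply: odeW sx.1 => //; exact: ltW.
apply/optimal_valueP => v z Lv sz.
have := @optimal_value_le a b eta _ _ (L2_if ac (ltW cb) Lu Lv)
  (state_if ac (ltW cb) sx sz).
rewrite opt lee_fin (real_cost_if ac cb Lu cx Lv (ode_mxcont sz.1)).
by rewrite (real_cost_split ac (ltW cb) Lu cx) lerD2l.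
Qed.

(** Here [Q] plays the role of [P a], and the left side is half the derivative of the value at [eta]
    along [zeta]. The cost of the perturbed pair bounds the value from above and touches it at
    [e = 0]. *)
Lemma value_gradient a b (Q : 'M[R]_n) eta u x y : a < b ->
  P0^T = P0 -> Q^T = Q ->
  (forall zeta, (dot (Q *m zeta) zeta)%:E = optimal_value A B C P0 a b zeta) ->
  L2 a b u -> state_eq A B a b eta u x ->
  optimal_value A B C P0 a b eta = (real_cost C P0 a b u x)%:E ->
  mxcont `[a, b] y ->
  (forall t, t \in `]a, b[ -> mxderiv t y (- (A^T *m y t) - C^T *m C *m x t)) ->
  y b = P0 *m x b ->
  forall zeta v0, dot (Q *m eta) zeta =
    dot (y a) zeta + \int[mu]_(s in `]a, b[) dot (u s + B^T *m y s) v0.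
Proof.
move=> ab P0_sym Qsym QV Lu sx opt cy dy yb zeta v0.
have cx := ode_mxcont sx.1.
(* The variation [z] starts at [zeta] and is driven by the constant control [v0], so that [x + e z]
   starts at [eta + e zeta] under the control [u + e v0]. *)
have [||z [za cz dz]] := @linear_ode_exists _ _ A a b a (fun=> B *m v0) zeta ab.
- by rewrite in_itv/= lexx ltW.
- exact: mxcont_cst.
have := adjoint_identity ab cx cy cz dy dz; rewrite yb za => adj.
apply: (@quadratic_tangent _ _ _ (dot (Q *m zeta) zeta)
  (real_cost C P0 a b (fun=> v0) z)) => e.
have := optimal_value_le (L2_perturb v0 e Lu) (state_perturb e cz dz sx).
rewrite -QV lee_fin real_cost_perturb// za.
(* By optimality the constant terms in [e] are equal on both sides and drop out. *)
have -> : real_cost C P0 a b u x = dot (Q *m eta) eta.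
  by apply: EFin_inj; rewrite -opt QV.
rewrite !(mulmxDr, dotDl, dotDr) -!scalemxAr !(dotZl, dotZr).
rewrite (dot_mulmxl _ zeta eta) Qsym (dotC zeta).
have i1 : mu.-integrable `]a, b[ (EFin \o (fun s => dot (C *m x s) (C *m z s))).
  apply: integrable_within_continuous.
  by apply: continuous_dot; exact: mxcont_mulcl.
have i2 : mu.-integrable `]a, b[ (EFin \o (fun s => dot (u s) v0)).
  by apply: integrable_dot_cst; exact: (L2_integrable Lu).1.
have i3 : mu.-integrable `]a, b[ (EFin \o (fun s => dot (B^T *m y s) v0)).
  apply: integrable_within_continuous; apply: continuous_dot.
    exact: mxcont_mulcl.
  exact: mxcont_cst.
have -> : \int[mu]_(s in `]a, b[) dot (u s + B^T *m y s) v0 =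
    \int[mu]_(s in `]a, b[) dot (u s) v0 +
    \int[mu]_(s in `]a, b[) dot (B^T *m y s) v0.
  rewrite -RintegralD//; apply: eq_Rintegral => s _; exact: dotDl.
rewrite RintegralD// (addrCA (dot _ _)) -adj; lra.
Qed.

End OptimalControl.

(** * The optimality system and the feedback law *)

Theorem theorem9p1 (R : realType) (n m p : nat)
    (A : 'M[R]_n) (B : 'M[R]_(n, p)) (C : 'M[R]_(m, n)) (P0 : 'M[R]_n)
    (P0_sym : P0^T = P0)
    (P0_nonneg : forall v : 'cV[R]_n, 0 <= dot (P0 *m v) v)
    (T : R) (T_gt0 : 0 < T)
    (P : R -> 'M[R]_n) (PE : value_matrix A B C P0 T P)
    (xi : 'cV[R]_n) (u : R -> 'cV[R]_p) (x : R -> 'cV[R]_n)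
    (u_opt : optimal_control A B C P0 T xi u)
    (x_state : state_eq A B 0 T xi u x) :
  (ode 0 T x (fun t => A *m x t + B *m u t) /\ x 0 = xi) /\
  (exists y : R -> 'cV[R]_n, adjoint_eq A C P0 T x y) /\
  (forall y : R -> 'cV[R]_n, adjoint_eq A C P0 T x y ->
     {ae (@lebesgue_measure R), forall t : R, t \in `]0, T[ ->
        u t = - (B^T *m y t)} /\
     (forall t : R, 0 <= t <= T -> y t = P t *m x t)) /\
  {ae (@lebesgue_measure R), forall t : R, t \in `[0, T] ->
     u t = - (B^T *m P t *m x t)}.
Proof.
set mu := @lebesgue_measure R.
have [Lu [x' [x'_state x'_opt]]] := u_opt.
have cx := ode_mxcont x_state.1.
(* Optimality is known for some trajectory [x'] of [u]; by uniqueness it coincides with [x] on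
   [[0, T]], so [x] has the same cost. *)
have opt : optimal_value A B C P0 0 T xi = (real_cost C P0 0 T u x)%:E.
  rewrite -x'_opt costE//; last exact: ode_mxcont x'_state.1.
  have xx' := state_unique T_gt0 x_state x'_state.
  rewrite /real_cost xx' ?in_itv/= ?lexx ?ltW//; congr (_ + _)%:E.
  apply: eq_Rintegral => s /[!inE]/= s0T; rewrite /running_cost xx'//.
  exact: subset_itv_oo_cc s0T.
have fE (y : R -> 'cV[R]_n) :
    (fun t => - (A^T *m y t) - C^T *m C *m x t) =
    (fun t => (- A^T) *m y t + (- (C^T *m C)) *m x t).
  by apply/funext => t; rewrite !mulNmx.
have cf (y : R -> 'cV[R]_n) : mxcont `[0, T] y ->
    mxcont `[0, T] (fun t => - (A^T *m y t) - C^T *m C *m x t).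
  by move=> cy; rewrite fE; apply: mxcontD; exact: mxcont_mulcl.
have exy : exists y : R -> 'cV[R]_n, adjoint_eq A C P0 T x y.
  (* The costate is solved backwards, with base point [T] and [x] as a continuous source term. *)
  have [||y [yT cy dy]] := @linear_ode_exists _ _ (- A^T) 0 T T
    (fun t => (- (C^T *m C)) *m x t) (P0 *m x T) T_gt0.
  - by rewrite in_itv/= lexx ltW.
  - exact: mxcont_mulcl.
  exists y; split=> //; apply: mxderiv_ode => //; first exact: cf.
  by move=> t /dy; rewrite !mulNmx.
have main (y : R -> 'cV[R]_n) : adjoint_eq A C P0 T x y ->
    {ae mu, forall t : R, t \in `]0, T[ -> u t = - (B^T *m y t)} /\
    (forall t : R, 0 <= t <= T -> y t = P t *m x t).
  move=> [oy yT]; have cy := ode_mxcont oy.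
  have dy := ode_mxderiv T_gt0 oy (cf _ cy).
  (* The tail of [(u, x)] on []t, T[] is optimal from [x t], so the gradient formula holds at every
     [t < T] with [zeta] and [v0] still free. *)
  have grad t zeta v0 : 0 <= t -> t < T -> dot (P t *m x t) zeta =
      dot (y t) zeta + \int[mu]_(s in `]t, T[) dot (u s + B^T *m y s) v0.
    move=> t0 tT; have [|Psym PV] := PE.1 t; first by rewrite t0.
    have sub : `[t, T] `<=` `[0, T] by apply: subset_itv; rewrite bnd_simp.
    apply: (@value_gradient _ _ _ _ A B C P0 t T _ _ u x) => //.
    - exact: L2W Lu.
    - by split=> //; apply: odeW x_state.1 => //; exact: ltW.
    - exact: dynamic_programming x_state opt.
    - by move=> i j; exact: continuous_subspaceW (cy i j).
    - move=> s /[!in_itv]/= /andP[ts sT]; apply: dy.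
      by rewrite in_itv/= sT (le_lt_trans t0).
  split; last first.
    move=> t /andP[t0]; rewrite le_eqVlt => /predU1P[->|tT].
      by rewrite PE.2.
    (* The choice [v0 = 0] removes the integral. *)
    apply: dot_inj => zeta; rewrite (grad t zeta 0)//.
    by under eq_Rintegral do rewrite dot0r; rewrite Rintegral_cst// mul0r addr0.
  have iw i : mu.-integrable `]0, T[
      (EFin \o (fun s => (u s + B^T *m y s) i ord0)).
    rewrite (_ : (fun s : R => _) = fun s => u s i ord0 + (B^T *m y s) i ord0).
      apply: integrable_addr; first exact: (L2_integrable Lu).1.
      by apply: integrable_within_continuous; exact: mxcont_mulcl.
    by apply/funext => s; rewrite mxE.
  (* With [zeta = 0] and [v0] a basis vector, the gradient formula isolates the integral of one
     component of [u + B^T y] over the tail. *)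
  have tail i t : 0 <= t -> t <= T ->
      \int[mu]_(s in `]t, T[) (u s + B^T *m y s) i ord0 = 0.
    move=> t0; rewrite le_eqVlt => /predU1P[->|tT].
      by rewrite set_itv_ge ?bnd_simp ?ltxx// Rintegral_set0.
    have := grad t 0 (delta_mx i ord0) t0 tT; rewrite !dot0r add0r => /esym <-.
    by apply: eq_Rintegral => s _; rewrite dot_deltar.
  have wi : {ae mu, forall t, forall i, t \in `]0, T[ ->
      (u t + B^T *m y t) i ord0 = 0}.
    apply: filter_forall => i.
    apply: ae_zero_of_Rintegral => // t /andP[t0 tT].
    (* The integral over []0, t[] is the difference of two tails, both zero. *)
    have := Rintegral_itv_split t0 tT (iw i).
    by rewrite !tail ?lexx ?(ltW T_gt0)// addr0.
  apply: filterS wi => [|t wt tT]; first exact: (ae_filter_ringOfSetsType mu).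
  apply/eqP; rewrite -addr_eq0; apply/eqP/matrixP => i j.
  by rewrite (ord1 j) wt// mxE.
split; first exact: x_state.
split; first exact: exy.
split; first exact: main.
have [y /main[uy yP]] := exy.
(* The formula for [u] is known on the open interval, whereas the claim is on the closed one; the
   two endpoints are null. *)
apply: filterS3 uy (ae_neq 0) (ae_neq T) => [|t uy t0 tT].
  exact: (ae_filter_ringOfSetsType mu).
rewrite in_itv/= => t0T; have /andP[t_ge0 t_leT] := t0T.
rewrite uy; last by rewrite in_itv/= !lt_neqAle eq_sym t0 tT.
by rewrite yP// mulmxA.
Qed.
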